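(* Fix a constant $C>0$. For $X>0$ let $$\mathcal{F}(X)=\#\{N=pq\le X:\ p\le q \text{ primes},\ q-p\le C N^{1/4}\}.$$ Then there is a constant $c>0$ (depending on $C$) such that $\mathcal{F}(X)\le c\,X^{3/4}/(\log X)^2$ for all sufficiently large $X$.
   Context: $\mathcal{F}(X)$ counts the products of two primes that are factorable by Fermat's difference-of-squares method, i.e. those whose prime factors differ by $O(N^{1/4})$. *)

(* Defs.v *)
From mathcomp Require Import all_boot all_order all_algebra finmap.
From mathcomp Require Import all_classical all_reals all_analysis.

Set Implicit Arguments.
Unset Strict Implicit.
Unset Printing Implicit Defensive.

Import Order.TTheory GRing.Theory Num.Theory.
Import numFieldNormedType.Exports.

Local Open Scope classical_set_scope.
Local Open Scope ring_scope.

Definition fermat_factorable (R : realType) (C X : R) : set nat :=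
  [set N : nat | N%:R <= X /\
    exists p q : nat, [/\ prime p, prime q, (p <= q)%N, N = (p * q)%N &
      q%:R - p%:R <= C * N%:R `^ (1 / 4)]].

(* [fset_set A] is empty by convention when [A] is infinite; this lemma shows
   that the convention never applies in [fermat_count]. *)
Lemma finite_fermat_factorable (R : realType) (C X : R) :
  finite_set (fermat_factorable C X).
Proof.
apply: (@sub_finite_set _ _ `I_(Num.truncn X).+1); last exact: finite_II.
move=> N [NX _] /=; rewrite ltnS truncn_ge_nat //.
exact: le_trans NX.
Qed.

Definition fermat_count (R : realType) (C X : R) : nat :=
  #|` fset_set (fermat_factorable C X)|.

(* Main.v *)
(** If N = pq <= X is counted, then p <= X^(1/2) and q - p < H, where H is about
    C X^(1/4). Cut [0, X^(1/2)] into blocks of length H: p and q both lie in one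
    of about X^(1/4)/C intervals of length 2H, so the count is at most the sum of
    the squares of the numbers of primes in these intervals. By the
    Brun-Titchmarsh bound each of these numbers is O(H / log H), which gives
    O(X^(3/4) / (log X)^2).

    The Brun-Titchmarsh bound comes from Selberg's sieve, in the form where the
    optimal weights are expressed by Ramanujan sums: for squarefree r <= z let
    f_r(n) be the product of 1 - p [p | n] over p | r. These functions are nearly
    orthogonal on intervals, with mean square phi(r), and equal 1 at primes
    n > z. Comparing the second moment of F = sum_r f_r / phi(r) with its value
    S = sum_r 1 / phi(r) at primes leaves at most H / S + z^4 primes above z, and
    S is at least (log z) / 2. *)
Require Import Defs.
From mathcomp Require Import all_boot all_order all_algebra finmap.
From mathcomp Require Import all_classical all_reals all_analysis.
From mathcomp Require Import ring lra zify.

Set Implicit Arguments.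
Unset Strict Implicit.
Unset Printing Implicit Defensive.

Import Order.TTheory GRing.Theory Num.Theory.
Import numFieldNormedType.Exports.

Local Open Scope classical_set_scope.
Local Open Scope ring_scope.

(** * Multiples and local factors over an interval *)

(** The range starts at [0], itself a multiple, hence a ceiling rather than a floor. *)
Lemma count_multiples_nat (m N : nat) : (0 < m)%N ->
  (\sum_(0 <= n < N) (m %| n) = (N + m.-1) %/ m)%N.
Proof.
move=> m0; elim: N => [|N IH]; first by rewrite big_geq // divn_small //; lia.
rewrite big_nat_recr //= IH addSn divnS // addnC; congr (_ + _)%N.
by rewrite -addnS prednK // dvdn_addl.
Qed.

Lemma count_multiples (R : realFieldType) (m M H : nat) : (0 < m)%N ->
  `|\sum_(M <= n < M + H | (m %| n)%N) 1 - H%:R / m%:R : R| <= 1.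
Proof.
move=> m0.
have mR : 0 < m%:R :> R by rewrite ltr0n.
have -> : \sum_(M <= n < M + H | (m %| n)%N) (1 : R) =
          (\sum_(M <= n < M + H) (m %| n))%N%:R.
  by rewrite big_mkcond natr_sum; apply: eq_bigr => n _; case: (m %| n)%N.
have E : (((\sum_(M <= n < M + H) (m %| n)) + (M + m.-1) %/ m =
          (M + H + m.-1) %/ m))%N.
  by rewrite -!count_multiples_nat // (big_cat_nat (leq0n M) (leq_addr H M)) addnC.
set c := (\sum_(_ <= n < _) _)%N in E *.
have e1 := divn_eq (M + m.-1) m; have e2 := divn_eq (M + H + m.-1) m.
have l1 := ltn_pmod (M + m.-1) m0; have l2 := ltn_pmod (M + H + m.-1) m0.
have b1 : (c * m <= H + m)%N by nia.
have b2 : (H <= c * m + m)%N by nia.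
rewrite -(ler_pM2r mR) mul1r -{2}(gtr0_norm mR) -normrM mulrBl divfK ?gt_eqF //.
move: b1 b2; rewrite -!(ler_nat R) !natrD natrM => b1 b2.
by rewrite ler_norml; apply/andP; split; lra.
Qed.

(** Induction on [L] with [m] varying: expanding the factor at [p] gives the sum over multiples of
    [m] minus [a p] times the sum over multiples of [m * p]. The two errors combine into the factor
    at [p] of the error bound. *)
Lemma sum_prod_dvd (R : realFieldType) (L : seq nat) (a : nat -> R) (M H m : nat) :
  (0 < m)%N -> uniq L -> all prime L -> all (coprime m) L ->
  `|\sum_(M <= n < M + H | (m %| n)%N) \prod_(p <- L) (1 - a p * (p %| n)%N%:R)
    - H%:R / m%:R * \prod_(p <- L) (1 - a p / p%:R)|
  <= \prod_(p <- L) (1 + `|a p|).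
Proof.
elim: L m => [|p L IH] m m0 /=.
  move=> _ _ _; rewrite !big_nil mulr1.
  under eq_bigr do rewrite big_nil.
  exact: count_multiples.
move=> /andP[pL uL] /andP[pp aL] /andP[cmp cmL].
have p0 := prime_gt0 pp.
have cpL : all (coprime (m * p)) L.
  apply/allP => q qL; rewrite coprimeMl (allP cmL) //= prime_coprime //.
  rewrite dvdn_prime2 //; last by rewrite (allP aL).
  by apply: contraNneq pL => ->.
have mp0 : (0 < m * p)%N by rewrite muln_gt0 m0.
have I1 := IH m m0 uL aL cmL; have I2 := IH _ mp0 uL aL cpL.
rewrite !big_cons.
have -> : \sum_(M <= n < M + H | (m %| n)%N)
     \prod_(q <- p :: L) (1 - a q * (q %| n)%N%:R) =
   \sum_(M <= n < M + H | (m %| n)%N) \prod_(q <- L) (1 - a q * (q %| n)%N%:R)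
   - a p * \sum_(M <= n < M + H | (m * p %| n)%N)
      \prod_(q <- L) (1 - a q * (q %| n)%N%:R).
  rewrite mulr_sumr (big_mkcond (fun n => (m * p %| n)%N)).
  rewrite [X in _ - X](_ : _ = \sum_(M <= n < M + H | (m %| n)%N)
     a p * (p %| n)%N%:R * \prod_(q <- L) (1 - a q * (q %| n)%N%:R)).
    rewrite -sumrB; apply: eq_bigr => n _.
    by rewrite big_cons mulrBl mul1r.
  rewrite [RHS]big_mkcond; apply: eq_bigr => n _.
  rewrite Gauss_dvd //; case: (m %| n)%N; case: (p %| n)%N => //=.
    by rewrite mulr1.
  by rewrite mulr0 mul0r.
set s1 := \sum_(_ <= n < _ | _) _ in I1 *.
set s2 := \sum_(_ <= n < _ | _) _ in I2 *.
set P := \prod_(q <- L) (1 - a q / q%:R) in I1 I2 *.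
set Q := \prod_(q <- L) _ in I1 I2 *.
have -> : s1 - a p * s2 - H%:R / m%:R * ((1 - a p / p%:R) * P) =
  (s1 - H%:R / m%:R * P) - a p * (s2 - H%:R / (m * p)%:R * P).
  by rewrite natrM; field; rewrite !pnatr_eq0 -!lt0n m0 p0.
rewrite (le_trans (ler_normB _ _)) // normrM mulrDl mul1r lerD //.
by rewrite ler_wpM2l.
Qed.

(** * Squarefree integers and sieve characters *)

Definition primes_upto (z : nat) : seq nat := [seq p <- index_iota 0 z.+1 | prime p].

(* For [0 < r <= z], [r] is squarefree iff [radical_upto z r = r]. *)
Definition radical_upto (z r : nat) : nat :=
  (\prod_(p <- primes_upto z) (if p %| r then p else 1))%N.

(* For squarefree [r <= z] this is mu(r) times the Ramanujan sum c_r(n). *)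
Definition sieve_char (R : realFieldType) (z r n : nat) : R :=
  \prod_(p <- primes_upto z) (if (p %| r)%N then 1 - p%:R * (p %| n)%N%:R else 1).

(** Euler's totient of [radical_upto z r], hence of [r] itself when [r] is squarefree and
    [0 < r <= z]. *)
Definition phi_upto (R : realFieldType) (z r : nat) : R :=
  \prod_(p <- primes_upto z) (if (p %| r)%N then p%:R - 1 else 1).

Lemma primes_uptoP (z p : nat) :
  (p \in primes_upto z) = prime p && (p <= z)%N.
Proof. by rewrite mem_filter mem_index_iota ltnS. Qed.

Lemma primes_upto_uniq (z : nat) : uniq (primes_upto z).
Proof. by rewrite filter_uniq // iota_uniq. Qed.

Lemma primes_upto_prime (z : nat) : all prime (primes_upto z).
Proof. exact: filter_all. Qed.

Lemma radical_upto_le (z r : nat) : (0 < r <= z)%N -> (radical_upto z r <= r)%N.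
Proof.
move=> /andP[r0 rz]; rewrite -{2}(partnT r0) (widen_partn _ rz).
rewrite /radical_upto big_filter big_mkcond [leqRHS]big_mkcond /=.
apply: leq_prod => p _; case: ifP => pp.
  have p0 := prime_gt0 pp.
  case: ifP => pr; last by rewrite expn_gt0 p0.
  rewrite -{1}(expn1 p) leq_pexp2l // -pfactor_dvdn //.
by rewrite lognE pp.
Qed.

Lemma radical_upto_eq (z r : nat) : (0 < r <= z)%N ->
  (forall p, prime p -> ~~ (p ^ 2 %| r)%N) -> radical_upto z r = r.
Proof.
move=> /andP[r0 rz] sf; rewrite -[RHS](partnT r0) (widen_partn _ rz).
rewrite /radical_upto big_filter big_mkcond [RHS]big_mkcond /=.
apply: eq_bigr => p _; case: ifP => pp; last by rewrite lognE pp.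
have := sf p pp; rewrite pfactor_dvdn // -ltnNge ltnS => l1.
case: ifP => pr; last by rewrite lognE pr !andbF.
have : (0 < logn p r)%N by rewrite logn_gt0 mem_primes pp r0.
by case: (logn p r) l1 => [|[|]] // _ _; rewrite expn1.
Qed.

(** Strong induction: if the square of a prime [p] divides [n], decompose [n / p ^ 2] and multiply
    its [m] by [p]; otherwise [n] is squarefree and [m = 1]. *)
Lemma radical_square_decomposition (z n : nat) : (0 < n <= z)%N ->
  exists r m, [/\ (0 < r <= z)%N, radical_upto z r = r, (0 < m <= z)%N
                & n = (r * m ^ 2)%N].
Proof.
elim/ltn_ind: n => n IH /andP[n0 nz].
case: (boolP (has (fun p => p ^ 2 %| n)%N (primes n))) => [/hasP[p]|/hasPn nsf].
  rewrite mem_primes => /and3P[pp _ _] /dvdnP[k nE].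
  have p1 := prime_gt1 pp.
  have k0 : (0 < k)%N by move: n0; rewrite nE muln_gt0 => /andP[].
  have kn : (k < n)%N by rewrite nE -{1}(muln1 k) ltn_pmul2l // (ltn_exp2l 0).
  have kz : (0 < k <= z)%N by rewrite k0 (leq_trans (ltnW kn)).
  have [r [m [rz rr /andP[m0 mz] kE]]] := IH k kn kz.
  exists r, (m * p)%N; split => //; last by rewrite nE kE expnMn mulnA.
  rewrite muln_gt0 m0 (ltnW p1) /= (leq_trans _ nz) // nE kE.
  have /andP[r0 _] := rz; rewrite -mulnA -expnMn.
  have mp : (0 < m * p)%N by rewrite muln_gt0 m0 ltnW.
  by rewrite (leq_trans (leq_pmull _ r0)) // leq_mul // -mulnn leq_pmulr.
have nz1 : (0 < n <= z)%N by rewrite n0.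
exists n, 1%N; split; rewrite ?exp1n ?muln1 ?(leq_trans n0 nz) //.
apply: radical_upto_eq => //.
move=> p pp; apply/negP => pn; suff /nsf : p \in primes n by rewrite pn.
by rewrite mem_primes pp n0 (dvdn_trans _ pn) // dvdn_exp.
Qed.

Lemma radical_upto_inj (z r s : nat) :
  radical_upto z r = r -> radical_upto z s = s ->
  all (fun p => (p %| r) == (p %| s))%N (primes_upto z) -> r = s.
Proof.
move=> rr ss /allP rs; rewrite -rr -ss; apply: eq_big_seq => p pz.
by have /eqP -> := rs p pz.
Qed.

Lemma phi_upto_gt0 (R : realFieldType) (z r : nat) : 0 < phi_upto R z r.
Proof.
rewrite /phi_upto big_seq; apply: prodr_gt0 => p.
rewrite primes_uptoP => /andP[pp _].
by case: ifP => // _; rewrite subr_gt0 ltr1n prime_gt1.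
Qed.

Lemma phi_upto_le (R : realFieldType) (z r : nat) : (0 < r <= z)%N ->
  phi_upto R z r <= r%:R.
Proof.
move=> rz; apply: le_trans (_ : (radical_upto z r)%:R <= _); last first.
  by rewrite ler_nat radical_upto_le.
rewrite /radical_upto natr_prod /phi_upto big_seq [leRHS]big_seq.
apply: ler_prod => p; rewrite primes_uptoP => /andP[pp _].
have : 1 <= p%:R :> R by rewrite ler1n prime_gt0.
by case: ifP => _ p1; lra.
Qed.

(** * Near-orthogonality and Selberg's sieve *)

(** The product of two characters has the form treated in [sum_prod_dvd], with [m = 1]. At a prime
    dividing exactly one of [r] and [s] the coefficient is [p], which kills the main term; if
    [r = s], each prime [p] dividing [r] contributes [1 - (2 * p - p ^ 2) / p = p - 1]. *)
Lemma sieve_char_correlation (R : realFieldType) (z r s M H : nat) :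
  (0 < r <= z)%N -> (0 < s <= z)%N ->
  radical_upto z r = r -> radical_upto z s = s ->
  \sum_(M <= n < M + H) sieve_char R z r n * sieve_char R z s n <=
  H%:R * ((r == s)%:R * phi_upto R z r) + z%:R ^+ 4.
Proof.
move=> rz sz rr ss.
pose a p : R := if (p %| r)%N then (if (p %| s)%N then p%:R *+ 2 - p%:R ^+ 2 else p%:R)
                else if (p %| s)%N then p%:R else 0.
have fE n : sieve_char R z r n * sieve_char R z s n =
    \prod_(p <- primes_upto z) (1 - a p * (p %| n)%N%:R).
  rewrite -big_split; apply: eq_bigr => p _ /=; rewrite /a.
  by do 3 case: (_ %| _)%N => /=; ring.
have mainE : \prod_(p <- primes_upto z) (1 - a p / p%:R) =
    (r == s)%:R * phi_upto R z r.
  have [rs|nrs] := eqVneq r s.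
    rewrite mul1r /phi_upto; apply: eq_big_seq => p.
    rewrite primes_uptoP /a -rs => /andP[pp _].
    have p0 : p%:R != 0 :> R by rewrite pnatr_eq0 -lt0n prime_gt0.
    by case: (p %| r)%N => /=; field.
  rewrite mul0r; apply/eqP; rewrite prodf_seq_eq0.
  have /allPn[p pz prs] : ~~ all (fun p => (p %| r) == (p %| s))%N (primes_upto z).
    by apply: contra nrs => h; apply/eqP/(@radical_upto_inj z).
  apply/hasP; exists p => //=.
  move: pz; rewrite primes_uptoP /a => /andP[pp _].
  have p0 : p%:R != 0 :> R by rewrite pnatr_eq0 -lt0n prime_gt0.
  by move: prs; case: (p %| r)%N; case: (p %| s)%N => //= _; rewrite divff // subrr.
have errE : \prod_(p <- primes_upto z) (1 + `|a p|) <= z%:R ^+ 4.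
  (* Each of [r] and [s] that [p] divides allows a factor [p ^ 2], so the error is at most
     [(r * s) ^ 2]. *)
  apply: le_trans (_ : (radical_upto z r)%:R ^+ 2 * (radical_upto z s)%:R ^+ 2 <= _).
    rewrite /radical_upto !natr_prod -!prodrXl -big_split /=.
    rewrite big_seq [leRHS]big_seq; apply: ler_prod => p.
    rewrite primes_uptoP => /andP[pp _].
    have p2 : 2 <= p%:R :> R by rewrite ler_nat prime_gt1.
    rewrite addr_ge0 //= /a; case: (_ %| r)%N; case: (_ %| s)%N.
    - by rewrite ler0_norm; nra.
    - by rewrite ger0_norm; nra.
    - by rewrite ger0_norm; nra.
    - by rewrite normr0; lra.
  rewrite rr ss -!natrX -natrM ler_nat.
  have /andP[_ rz'] := rz; have /andP[_ sz'] := sz.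
  by rewrite (expnD z 2 2) leq_mul // leq_exp2r.
have := @sum_prod_dvd R (primes_upto z) a M H 1 isT (primes_upto_uniq z)
  (primes_upto_prime z).
rewrite mainE divr1 => /(_ _) => h.
under eq_bigr do rewrite fE.
have {}h := h _; rewrite -lerBlDl (le_trans (ler_norm _)) // (le_trans _ errE) //.
rewrite (eq_bigl _ _ (fun n => dvd1n n)) in h; apply: h.
by apply/allP => p _; rewrite coprime1n.
Qed.

(* The function [F n := sum_r sieve_char r n / phi r] equals [S] at every prime
   above [z], and near-orthogonality of the [sieve_char r] bounds its second
   moment by [H * S + z ^ 4 * S ^ 2]. *)
Lemma selberg_sieve (R : realFieldType) (z M H : nat) (S : R) :
  S = \sum_(1 <= r < z.+1 | radical_upto z r == r) (phi_upto R z r)^-1 -> 0 < S ->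
  (\sum_(M <= n < M + H | prime n && (z < n)%N) 1)%:R <= H%:R / S + z%:R ^+ 4.
Proof.
move=> SE S0.
pose F n : R := \sum_(1 <= r < z.+1 | radical_upto z r == r)
   (phi_upto R z r)^-1 * sieve_char R z r n.
have FS n : prime n -> (z < n)%N -> F n = S.
  move=> pn zn; rewrite SE; apply: eq_bigr => r _.
  rewrite /sieve_char big1_seq ?mulr1 // => p; rewrite primes_uptoP.
  move=> /= /andP[pp pz].
  rewrite (dvdn_prime2 pp pn) (_ : (p == n) = false) ?mulr0 ?subr0 ?if_same //.
  by apply/negbTE; rewrite neq_ltn (leq_ltn_trans pz zn).
have lo : S ^+ 2 * (\sum_(M <= n < M + H | prime n && (z < n)%N) 1)%:R <=
    \sum_(M <= n < M + H) F n ^+ 2.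
  rewrite natr_sum mulr_sumr big_mkcond /=; apply: ler_sum => n _.
  case: ifP => [/andP[pn zn]|_]; last exact: sqr_ge0.
  by rewrite FS // mulr1.
have up : \sum_(M <= n < M + H) F n ^+ 2 <= H%:R * S + z%:R ^+ 4 * S ^+ 2.
  have -> : \sum_(M <= n < M + H) F n ^+ 2 =
    \sum_(1 <= r < z.+1 | radical_upto z r == r)
    \sum_(1 <= s < z.+1 | radical_upto z s == s)
      (phi_upto R z r)^-1 * (phi_upto R z s)^-1 *
      \sum_(M <= n < M + H) sieve_char R z r n * sieve_char R z s n.
    rewrite (eq_bigr (fun n => \sum_(1 <= r < z.+1 | radical_upto z r == r)
    \sum_(1 <= s < z.+1 | radical_upto z s == s)
      (phi_upto R z r)^-1 * (phi_upto R z s)^-1 *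
        (sieve_char R z r n * sieve_char R z s n))); last first.
      move=> n _; rewrite expr2 {1}/F mulr_suml; apply: eq_bigr => r _.
      by rewrite mulr_sumr; apply: eq_bigr => s _; ring.
    rewrite exchange_big; apply: eq_bigr => r _.
    rewrite exchange_big; apply: eq_bigr => s _.
    by rewrite mulr_sumr.
  apply: le_trans (_ : \sum_(1 <= r < z.+1 | radical_upto z r == r)
    \sum_(1 <= s < z.+1 | radical_upto z s == s)
      (phi_upto R z r)^-1 * (phi_upto R z s)^-1 *
      (H%:R * ((r == s)%:R * phi_upto R z r) + z%:R ^+ 4) <= _).
    rewrite big_nat_cond [leRHS]big_nat_cond; apply: ler_sum => r.
    move=> /andP[rz /eqP rr].
    rewrite big_nat_cond [leRHS]big_nat_cond; apply: ler_sum => s.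
    move=> /andP[sz /eqP ss].
    rewrite ler_wpM2l ?sieve_char_correlation //.
    by rewrite mulr_ge0 // invr_ge0 ltW ?phi_upto_gt0.
  (* On the diagonal one factor [1 / phi r] cancels, leaving [H * S]; the errors add up to
     [z ^ 4 * S ^ 2]. *)
  rewrite {1}SE mulr_sumr expr2 {1}SE mulr_suml mulr_sumr -big_split /=.
  rewrite big_nat_cond [leRHS]big_nat_cond; apply: ler_sum => r.
  move=> /andP[rz rr].
  rewrite SE mulr_sumr mulr_sumr.
  under eq_bigr do rewrite mulrDr; rewrite big_split /= lerD //; last first.
    by apply: ler_sum => s _; rewrite mulrC.
  rewrite big_mkcond (bigD1_seq r) ?iota_uniq ?mem_index_iota //= rr eqxx.
  rewrite big1 ?addr0 => [|s sr].
    rewrite mul1r; have p0 := phi_upto_gt0 R z r.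
    by rewrite le_eqVlt; apply/orP; left; apply/eqP; field; rewrite gt_eqF.
  by rewrite [r == s]eq_sym (negbTE sr) mul0r !mulr0 if_same.
rewrite -(ler_pM2l (exprn_gt0 2 S0)); apply: le_trans (le_trans lo up) _.
by rewrite le_eqVlt; apply/orP; left; apply/eqP; field; rewrite gt_eqF.
Qed.

(** * Logarithmic lower bound for the sum of [1 / phi r] *)

Lemma sum_inv_squares (R : realFieldType) (N : nat) :
  \sum_(1 <= m < N.+1) (m%:R ^+ 2)^-1 <= 2 :> R.
Proof.
case: N => [|N]; first by rewrite big_geq.
(* The sharper bound is the one that telescopes, by [1 / (x + 1) ^ 2 <= 1 / x - 1 / (x + 1)]. *)
apply: (@le_trans _ _ (2 - (N.+1%:R)^-1)); last first.
  by rewrite gerBl invr_ge0.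
elim: N => [|N IH]; first by rewrite big_nat1 /= invr1; lra.
rewrite big_nat_recr //=; apply: le_trans (lerD IH (lexx _)) _.
have n0 : 1 <= N.+1%:R :> R by rewrite ler1n.
rewrite -[N.+2]addn1 natrD; move: (N.+1%:R : R) n0 => x n0.
suff : ((x + 1) ^+ 2)^-1 <= x^-1 - (x + 1)^-1 by lra.
have -> : x^-1 - (x + 1)^-1 = (x * (x + 1))^-1.
  by field; rewrite !gt_eqF //; lra.
rewrite lef_pV2 ?posrE; nra.
Qed.

Lemma le_sum_mem (R : realFieldType) (s : seq nat) (P : pred nat)
    (F : nat -> R) (i : nat) :
  (forall j, 0 <= F j) -> i \in s -> P i -> F i <= \sum_(j <- s | P j) F j.
Proof.
move=> F0 si Pi; rewrite (big_rem i) //= Pi lerDl.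
by apply: sumr_ge0.
Qed.

Lemma sum_eq_uniq_le1 (R : realFieldType) (s : seq nat) (k : nat) :
  uniq s -> \sum_(n <- s) (n == k)%:R <= 1 :> R.
Proof.
move=> us; rewrite -natr_sum lern1 -big_mkcond /= sum1_count.
by rewrite count_uniq_mem // leq_b1.
Qed.

(* Every [n <= z] is [r * m ^ 2] with [r] squarefree, and the sum of
   [1 / m ^ 2] is at most [2]. *)
Lemma harmonic_le_sum_inv_phi (R : realFieldType) (z : nat) :
  \sum_(1 <= n < z.+1) n%:R^-1 <=
  2 * \sum_(1 <= r < z.+1 | radical_upto z r == r) (phi_upto R z r)^-1.
Proof.
(* All terms being nonnegative, a single representation [n = r * m ^ 2] already yields [1 / n]. *)
apply: (@le_trans _ _ (\sum_(1 <= n < z.+1)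
  \sum_(1 <= r < z.+1 | radical_upto z r == r) \sum_(1 <= m < z.+1)
     (r%:R^-1 * (m%:R ^+ 2)^-1) * (n == (r * m ^ 2)%N)%:R)).
  rewrite big_nat_cond [leRHS]big_nat_cond; apply: ler_sum => n /andP[nz _].
  have [r [m [rz rr mz nE]]] := radical_square_decomposition nz.
  have F0 r' m' : 0 <= (r'%:R^-1 * (m'%:R ^+ 2)^-1) * (n == (r' * m' ^ 2)%N)%:R :> R.
    by rewrite !mulr_ge0 ?invr_ge0 ?exprn_ge0.
  have /eqP rr' := rr.
  apply: le_trans (@le_sum_mem R _
    (fun r => radical_upto z r == r)
    (fun r => \sum_(1 <= m < z.+1)
       (r%:R^-1 * (m%:R ^+ 2)^-1) * (n == (r * m ^ 2)%N)%:R)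
     r _ _ rr'); rewrite ?mem_index_iota //; last by move=> j; apply: sumr_ge0.
  apply: le_trans (@le_sum_mem R _ xpredT
    (fun m => (r%:R^-1 * (m%:R ^+ 2)^-1) * (n == (r * m ^ 2)%N)%:R) m _ _ isT);
    rewrite ?mem_index_iota //.
  by rewrite -nE eqxx mulr1 nE natrM natrX invfM.
(* For fixed [r] and [m] at most one [n] matches; the rest is the bound [2] and [phi r <= r]. *)
rewrite exchange_big /= mulr_sumr big_nat_cond [leRHS]big_nat_cond.
apply: ler_sum => r /andP[rz /eqP rr]; rewrite exchange_big /=.
apply: (@le_trans _ _ (\sum_(1 <= m < z.+1) r%:R^-1 * (m%:R ^+ 2)^-1)).
  apply: ler_sum => m _; rewrite -mulr_sumr ler_piMr ?sum_eq_uniq_le1 ?iota_uniq //.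
rewrite -mulr_sumr mulrC ler_pM ?sumr_ge0 ?sum_inv_squares ?invr_ge0 //.
have /andP[r0 _] := rz.
by rewrite lef_pV2 ?posrE ?phi_upto_gt0 ?ltr0n // phi_upto_le.
Qed.

(** Sum [ln (1 + 1 / n) <= 1 / n]; the left side telescopes. *)
Lemma ln_le_harmonic (R : realType) (z : nat) :
  ln z.+1%:R <= \sum_(1 <= n < z.+1) n%:R^-1 :> R.
Proof.
elim: z => [|z IH]; first by rewrite ln1 big_geq.
rewrite big_nat_recr //=; apply: le_trans (lerD IH (lexx _)).
have z0 : 0 < z.+1%:R :> R by rewrite ltr0n.
have zi : 0 < z.+1%:R^-1 :> R by rewrite invr_gt0.
have -> : z.+2%:R = z.+1%:R * (1 + z.+1%:R^-1) :> R.
  by rewrite mulrDr mulr1 divff ?gt_eqF // natr1.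
by rewrite lnM ?posrE ?addr_gt0 // lerD2l le_ln1Dx // (lt_trans (ltrN10 _) zi).
Qed.

(** Brun-Titchmarsh with a free sieving level: the term [z] covers the primes up to [z], the other
    two come from [selberg_sieve]. *)
Lemma primes_in_interval_le (R : realType) (z M H : nat) : (0 < z)%N ->
  (count prime (index_iota M (M + H)))%:R <=
    z%:R + 2 * H%:R / ln z.+1%:R + z%:R ^+ 4 :> R.
Proof.
move=> z0.
pose S : R := \sum_(1 <= r < z.+1 | radical_upto z r == r) (phi_upto R z r)^-1.
have lnz : 0 < ln z.+1%:R :> R by rewrite ln_gt0 // ltr1n.
have lnS : ln z.+1%:R <= 2 * S.
  exact: le_trans (ln_le_harmonic R z) (harmonic_le_sum_inv_phi R z).
have S0 : 0 < S by lra.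
have := @selberg_sieve R z M H S erefl S0; rewrite sum1_count => hS.
have HS : H%:R / S <= 2 * H%:R / ln z.+1%:R.
  rewrite ler_pdivrMr // mulrAC ler_pdivlMr //.
  have H0 : 0 <= H%:R :> R by [].
  nra.
have hc : (count prime (index_iota M (M + H)) <= z +
   count (fun n => prime n && (z < n)) (index_iota M (M + H)))%N.
  rewrite -!size_filter.
  rewrite -(count_predC (fun n => z < n)%N) -!size_filter -!filter_predI addnC.
  apply: leq_add; last by rewrite !size_filter; apply: sub_count => n /=; rewrite andbC.
  rewrite -[leqRHS](size_iota 1 z); apply: uniq_leq_size.
    by rewrite filter_uniq // iota_uniq.
  move=> n; rewrite mem_filter /= mem_index_iota -leqNgt => /andP[/andP[nz pn] _].
  by rewrite mem_iota add1n ltnS nz prime_gt0.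
apply: (@le_trans _ _ 
  (z%:R + (count (fun n => prime n && (z < n)%N) (index_iota M (M + H)))%:R)).
  by rewrite -natrD ler_nat.
by lra.
Qed.

(** * Counting products of two close primes *)

(** Both primes lie in the window with index [k = p %/ H], so [N] is listed among the products of
    pairs from that window; repetitions only lengthen the list. *)
Lemma card_fset_set_prime_products (A : set nat) (K H : nat) : finite_set A ->
  (forall N, A N -> exists p q, [/\ prime p, prime q, (p < K * H)%N,
     (p <= q < p + H)%N & N = (p * q)%N]) ->
  (#|` fset_set A| <=
   \sum_(0 <= k < K) count prime (index_iota (k * H) (k * H + 2 * H)) ^ 2)%N.
Proof.
move=> finA AE.
pose P k := [seq n <- index_iota (k * H) (k * H + 2 * H) | prime n].
pose L := flatten [seq [seq (p * q)%N | p <- P k, q <- P k] | k <- index_iota 0 K].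
have -> : (\sum_(0 <= k < K) count prime (index_iota (k * H) (k * H + 2 * H)) ^ 2)%N
    = size L.
  rewrite size_flatten sumnE /shape !big_map; apply: eq_bigr => k _.
  by rewrite size_allpairs size_filter mulnn.
apply: uniq_leq_size; first exact: fset_uniq.
move=> N; rewrite -[N \in _]/(N \in fset_set A) in_fset_set // inE => /AE.
move=> [p [q [pp pq pK /andP[pleq qp] ->]]].
have H0 : (0 < H)%N by case: H pK {AE P L qp} => //; rewrite muln0.
have pE := divn_eq p H; have pm := ltn_pmod p H0.
apply/flattenP; exists [seq (a * b)%N | a <- P (p %/ H)%N, b <- P (p %/ H)%N].
  by apply/mapP; exists (p %/ H)%N => //; rewrite mem_index_iota /= ltn_divLR.
apply/allpairsP; exists (p, q); split => //=;
  rewrite mem_filter mem_index_iota ?pp ?pq /=; apply/andP; split; lia.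
Qed.

(** For [X = w ^ 32], [w ^ 8] is the fourth root and [w ^ 16] the square root of [X]: [H] exceeds
    every gap [q - p], and [K] blocks of length [H] reach past every [p]. *)
Lemma fermat_count_le (R : realType) (C w : R) (z H K : nat) :
  0 < C -> 1 < w -> (0 < z)%N ->
  C * w ^+ 8 < H%:R -> w ^+ 16 < (K * H)%:R ->
  (fermat_count C (w ^+ 32))%:R <=
    K%:R * (z%:R + 2 * (2 * H)%:R / ln z.+1%:R + z%:R ^+ 4) ^+ 2 :> R.
Proof.
move=> C0 w1 z0 hH hK.
have w0 : 0 <= w by lra.
apply: le_trans (_ : (\sum_(0 <= k < K)
  count prime (index_iota (k * H) (k * H + 2 * H)) ^ 2)%N%:R <= _).
  rewrite ler_nat; apply: card_fset_set_prime_products.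
    exact: finite_fermat_factorable.
  move=> N [NX [p [q [pp pq pleq NE qp]]]]; exists p, q.
  have N4 : N%:R `^ (1 / 4) <= w ^+ 8.
    have -> : w ^+ 8 = (w ^+ 32) `^ (1 / 4).
      rewrite -!powR_mulrn // -powRrM; congr (_ `^ _); lra.
    by rewrite ge0_ler_powR // ?nnegrE ?exprn_ge0 //; lra.
  split => //.
    rewrite -(ltr_nat R); apply: le_lt_trans hK.
    rewrite -(@ler_pXn2r _ 2) ?nnegrE ?exprn_ge0 // -exprM.
    apply: le_trans NX; rewrite NE -natrX ler_nat -mulnn leq_mul //.
  rewrite pleq /= -(ltr_nat R) natrD -ltrBlDl; apply: le_lt_trans hH.
  by apply: le_trans qp _; rewrite ler_pM2l.
rewrite natr_sum mulr_natl -[K in leRHS]subn0 -sumr_const_nat.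
apply: ler_sum => k _; rewrite natrX.
rewrite ler_pXn2r ?nnegrE // ?primes_in_interval_le //.
exact: le_trans (primes_in_interval_le R (k * H) _ z0).
Qed.

Theorem theorem2 (R : realType) (C : R) (hC : 0 < C) :
  exists c : R, 0 < c /\
    \forall X \near +oo, (fermat_count C X)%:R <= c * X `^ (3 / 4) / (ln X) ^+ 2.
Proof.
have Ci : 0 < C^-1 by rewrite invr_gt0.
(* The [2] pays for [z] and [z ^ 4], and [4 * (C + 1)] for the main term, where
   [h.+1 <= (C + 1) * w ^ 8]. *)
pose D : R := 2 + 4 * (C + 1).
have D0 : 0 < D by rewrite /D; lra.
(* The factors come from the number of blocks, the squared prime count per window, and
   [ln X = 32 * ln w]. *)
exists ((C^-1 + 1) * D ^+ 2 * 32 ^+ 2); split.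
  apply: mulr_gt0; last exact: exprn_gt0.
  by apply: mulr_gt0; [exact: addr_gt0|exact: exprn_gt0].
near=> X.
have X1 : 1 < X by near: X; exact: nbhs_pinfty_gt.
(* With [w = X ^ (1 / 32)] all the powers of [X] that occur are integral powers
   of [w]; sieving up to [w] leaves an error [w ^ 4], negligible against [w ^ 8]. *)
pose w := X `^ (1 / 32).
have w0 : 0 <= w by exact: powR_ge0.
have XE : X = w ^+ 32.
  rewrite -powR_mulrn // /w -powRrM (_ : 1 / 32 * 32%:R = 1); last by lra.
  by rewrite powRr1 //; lra.
have w1 : 1 < w.
  rewrite -(@ltr_pXn2r _ 32) ?nnegrE // -XE expr1n //.
have X34 : X `^ (3 / 4) = w ^+ 24.
  by rewrite -powR_mulrn // /w -powRrM; congr (_ `^ _); lra.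
have lw0 : 0 < ln w by exact: ln_gt0.
have lX : ln X = 32 * ln w by rewrite XE lnXn; [rewrite mulr_natl|lra].
have lww : ln w <= w.
  have h : -1 < w - 1 by lra.
  by have := le_ln1Dx h; rewrite [1 + _]addrC subrK; lra.
have [zw wz] : (Num.truncn w)%:R <= w /\ w < (Num.truncn w).+1%:R.
  by have /andP[] := truncn_itv w0.
have z0 : (0 < Num.truncn w)%N by rewrite truncn_ge_nat //; lra.
move: (Num.truncn w) zw wz z0 => z zw wz z0.
(* This absorbs the units added in rounding up to [h.+1] and [k.+1]. *)
have w8 : 1 <= w ^+ 8 by rewrite exprn_ege1 // ltW.
have Cw0 : 0 <= C * w ^+ 8 by rewrite mulr_ge0 ?exprn_ge0 // ltW.
have /andP[Hw wH] := truncn_itv Cw0.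
move: (Num.truncn (C * w ^+ 8)) Hw wH => h Hw wH.
have H0 : 0 < h.+1%:R :> R by rewrite ltr0n.
have KK0 : 0 <= w ^+ 16 / h.+1%:R by rewrite divr_ge0 ?exprn_ge0.
have /andP[Kw wK] := truncn_itv KK0.
move: (Num.truncn (w ^+ 16 / h.+1%:R)) Kw wK => k Kw wK.
have wKH : w ^+ 16 < (k.+1 * h.+1)%:R.
  by rewrite natrM -ltr_pdivrMr.
rewrite {1}XE X34 lX; apply: le_trans (fermat_count_le hC w1 z0 wH wKH) _.
have kle : k.+1%:R <= (C^-1 + 1) * w ^+ 8.
  rewrite -natr1 mulrDl mul1r lerD //; apply: le_trans Kw _.
  rewrite ler_pdivrMr // (_ : w ^+ 16 = C^-1 * w ^+ 8 * (C * w ^+ 8)).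
    by rewrite ler_wpM2l ?ltW // mulr_gt0 // exprn_gt0 // (lt_trans ltr01).
  by field; rewrite gt_eqF.
(* Amounts to [ln w <= w <= w ^ 4]. *)
have wl : w ^+ 4 <= w ^+ 8 / ln w.
  rewrite ler_pdivlMr // (exprD w 4 4) ler_pM2l ?exprn_gt0 //; last by lra.
  by apply: le_trans lww _; rewrite ler_eXnr // ltW.
have B : z%:R + 2 * (2 * h.+1)%:R / ln z.+1%:R + z%:R ^+ 4 <= D * (w ^+ 8 / ln w).
  have b1 : z%:R <= w ^+ 4 by apply: le_trans zw _; rewrite ler_eXnr // ltW.
  have b2 : z%:R ^+ 4 <= w ^+ 4 by rewrite lerXn2r ?nnegrE.
  have b3 : 2 * (2 * h.+1)%:R / ln z.+1%:R <= 4 * (C + 1) * (w ^+ 8 / ln w).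
    rewrite mulrA; apply: ler_pM.
    - by rewrite mulr_ge0.
    - by rewrite invr_ge0 ln_ge0 // ler1n.
    - by rewrite natrM -natr1; nra.
    - rewrite lef_pV2 ?posrE ?ln_gt0 ?ltr1n // ler_ln ?posrE ?ltr0n //; lra.
  rewrite /D mulrDl; lra.
apply: (@le_trans _ _ ((C^-1 + 1) * w ^+ 8 * (D * (w ^+ 8 / ln w)) ^+ 2)).
  have A0 : 0 <= z%:R + 2 * (2 * h.+1)%:R / ln z.+1%:R + z%:R ^+ 4 :> R.
    by rewrite !addr_ge0 ?exprn_ge0 // divr_ge0 ?mulr_ge0 // ln_ge0 // ler1n.
  by rewrite ler_pM // ?sqr_ge0 // lerXn2r ?nnegrE // (le_trans A0 B).
by rewrite le_eqVlt; apply/orP; left; apply/eqP; field; rewrite !lt0r_neq0.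
Unshelve. all: by end_near. Qed.
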